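(* Potentials satisfying the exponential expansion hypothesis, described by their coefficients $V_j^\pm$, generically satisfy $V\notin\mathcal{RC}$, in the following sense. For each choice of sign $\pm$ (and given $A_\pm>0$), the set of sequences $(V_j^\pm)_{j\ge1}\in\mathbb C^{\mathbb N}$ that satisfy, for some $j\in\mathbb Z_{\ge2}$, the resonant condition $$V_j^\pm=\sum_{r=2}^j(-1)^rA_\pm^{2(1-r)}\sum_{\beta\in\mathbb Z_{\ge1}^r,\ |\beta|=j}\frac{V_\beta^\pm}{\prod_{k=1}^{r-1}|\beta|_k\,(j-|\beta|_k)}$$ is a meagre subset (a countable union of nowhere dense subsets) of $\mathbb C^{\mathbb N}$ with the product topology.
   Context: For $\beta=(\beta_1,\dots,\beta_r)\in\mathbb Z_{\ge1}^r$: $|\beta|=\beta_1+\dots+\beta_r$, $V_\beta^\pm=V_{\beta_1}^\pm\cdots V_{\beta_r}^\pm$, $|\beta|_k=\beta_1+\dots+\beta_k$. The exponential expansion hypothesis on $V$ is: there are constants $A_\pm>0$, $R>0$ and $F_\pm$ holomorphic near $0$ with $F_\pm(0)=0$, $F_\pm'(0)\ne0$, $V(x)=F_\pm(e^{\mp A_\pm x})$ for $\pm x>R$; the coefficients are given by $F_\pm(z)=\sum_{j\ge1}V_j^\pm z^j$. $V\in\mathcal{RC}_j^\pm$ when the displayed condition holds for that $j\ge2$ and sign, and $\mathcal{RC}=\bigcup_\pm\bigcup_{j\ge2}\mathcal{RC}_j^\pm$. *)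

(* Defs.v *)
From HB Require Import structures.
From mathcomp Require Export all_boot all_order all_algebra.
From mathcomp Require Export all_classical all_reals all_analysis.
From mathcomp Require Export complex.

Set Implicit Arguments.
Unset Strict Implicit.
Unset Printing Implicit Defensive.

Import Order.TTheory GRing.Theory Num.Theory.
Import numFieldNormedType.Exports.

Local Open Scope classical_set_scope.
Local Open Scope ring_scope.

Definition nowhere_dense {T : topologicalType} (A : set T) : Prop :=
  (closure A)° = set0.

Definition meagre {T : topologicalType} (A : set T) : Prop :=
  exists F : nat -> set T,
    (forall n, nowhere_dense (F n)) /\ A = \bigcup_n F n.

Inductive sign : Set := Plus | Minus.

(* C^N with the product topology.  Sequences (V_j) are indexed by j >= 1, so
   the entry number n : nat of such a sequence is the coefficient V_(n+1). *)
Definition coef_seq (R : realType) : topologicalType :=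
  prod_topology (fun _ : nat => R[i]^o).

(* V_j, for j >= 1; the junk value at j = 0 is never used below. *)
Definition coef (R : realType) (v : coef_seq R) (j : nat) : R[i] := v j.-1.

(* The beta in (Z_{>=1})^r with |beta| = j.  Bounding the entries of beta by j
   loses nothing and makes the type of candidates finite. *)
Definition compositions (r j : nat) : {set {ffun 'I_r -> 'I_j.+1}} :=
  [set b : {ffun 'I_r -> 'I_j.+1} |
    [forall i, (0 < b i)%N] && ((\sum_i b i)%N == j)]%SET.

(* |beta|_k = beta_1 + ... + beta_k (the entries are numbered from 0 here). *)
Definition psum (r j : nat) (b : {ffun 'I_r -> 'I_j.+1}) (k : nat) : nat :=
  (\sum_(i < r | (i < k)%N) b i)%N.

Definition coef_prod (R : realType) (v : coef_seq R) (r j : nat)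
    (b : {ffun 'I_r -> 'I_j.+1}) : R[i] :=
  \prod_(i < r) coef v (b i).

Definition resonant (R : realType) (A : R) (j : nat) (v : coef_seq R) : Prop :=
  coef v j =
    \sum_(2 <= r < j.+1)
      (-1) ^+ r * (A%:C)%C ^ (2 * (1 - r%:Z)) *
      \sum_(b in compositions r j)
        coef_prod v b /
        \prod_(1 <= k < r) ((psum b k)%:R * (j%:R - (psum b k)%:R)).

(* Main.v *)
Require Import Defs.
Import Order.TTheory GRing.Theory Num.Theory.
Import numFieldNormedType.Exports.
Local Open Scope classical_set_scope.
Local Open Scope ring_scope.

(** For a fixed j >= 2 the resonant condition reads V_j = Q_j(V), where Q_j is
a polynomial in finitely many coefficients: it is a finite sum of monomials
V_beta.  A composition beta of j with at least two positive parts has all its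
parts strictly below j, so Q_j involves only V_1, ..., V_(j-1) and the condition
describes the graph of a continuous function of the other coordinates.  Such a
graph is closed ([closed_coord_graph]) and has no interior, because on a line
parallel to the j-th axis it contains exactly one point, and a singleton is not
open in the scalar field ([not_nbhs_set1]); hence it is nowhere dense
([nowhere_dense_coord_graph]).  The set of the statement is the countable union
of these graphs over j >= 2. *)

Lemma not_nbhs_set1 (K : numFieldType) (c : K) : ~ nbhs c [set c].
Proof.
move=> /nbhs_ballP[e /= e0 /(_ (c + e / 2))].
rewrite -ball_normE /ball_ /= opprD addrA subrr add0r normrN.
rewrite gtr0_norm ?divr_gt0// => H.
have /H /eqP : e / 2 < e by rewrite ltr_pdivrMr// ltr_pMr// ltr1n.
by rewrite -subr_eq0 addrC addKr mulf_eq0 invr_eq0 pnatr_eq0 orbF gt_eqF.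
Qed.

Lemma closed_coord_graph (K : numFieldType) (I : eqType) (i : I)
    (g : prod_topology (fun _ : I => K) -> K) :
  continuous g -> closed [set v : prod_topology (fun _ : I => K) | v i = g v].
Proof.
move=> cg.
have ci : continuous (fun v : prod_topology (fun _ : I => K) => v i : K).
  exact: (@proj_continuous I (fun=> K) i).
have cd : continuous (fun v : prod_topology (fun _ : I => K) => v i - g v : K).
  by move=> v; exact: (@cvgB K K _ _ _ _ _ _ _ (ci v) (cg v)).
rewrite (_ : [set v | _] = (fun v => v i - g v) @^-1` [set 0]); last first.
  by apply/seteqP; split=> v /= => [->|/subr0_eq]; rewrite ?subrr.
apply: preimage_closed; first by move=> v _; exact: cd.
apply: accessible_closed_set1.
by apply: hausdorff_accessible; exact: norm_hausdorff.
Qed.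

(** If [v] were interior to the graph, moving its [i]-th coordinate [t] alone
would stay in the graph for all [t] near [v i]; but [g] does not change along
this line, so [t] is forced to be the single value [g v]. *)
Lemma nowhere_dense_coord_graph (K : numFieldType) (I : eqType) (i : I)
    (g : prod_topology (fun _ : I => K) -> K) :
  continuous g -> (forall v t, g (@dfwith I (fun=> K) v i t) = g v :> K) ->
  nowhere_dense [set v : prod_topology (fun _ : I => K) | v i = g v].
Proof.
move=> cg gi; rewrite /nowhere_dense -(closure_id _).1; last first.
  exact: closed_coord_graph.
apply/seteqP; split=> // v /= vint; have vi : v i = g v.
  exact: (nbhs_singleton vint).
apply: (@not_nbhs_set1 K (v i)).
have line_v : @dfwith I (fun=> K) v i (v i) = v.
  by apply/funext => j; case: dfwithP.
have line_cont := @dfwith_continuous I (fun=> K) v i (v i).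
rewrite /continuous_at line_v in line_cont.
apply: (@filterS K (nbhs (v i)) _ _ _ _ (line_cont _ vint)) => t /=.
by rewrite gi dfwithin vi.
Qed.

(** As every part is positive, a part equal to [j] would leave nothing for the
other ones. *)
Lemma composition_part_lt r j (b : {ffun 'I_r -> 'I_j.+1}) (i : 'I_r) :
  (2 <= r)%N -> b \in compositions r j -> (0 < b i < j)%N.
Proof.
move=> r2; rewrite inE => /andP[/forallP b0 /eqP sb]; rewrite b0 /=.
have [k ki] : exists k : 'I_r, k != i.
  have : (0 < #|predC1 i|)%N by rewrite cardC1 card_ord -subn1 subn_gt0.
  by case/card_gt0P => k; rewrite inE => ki; exists k.
rewrite -[X in (_ < X)%N]sb (bigD1 i) //= (bigD1 k) //= -addn1 leq_add2l.
by rewrite addn_gt0 b0.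
Qed.

Lemma continuous_sum (K : numFieldType) (T : topologicalType) (I : Type)
    (r : seq I) (P : pred I) (f : I -> T -> K) :
  (forall i, P i -> continuous (f i)) ->
  continuous (fun x => \sum_(i <- r | P i) f i x).
Proof. by apply: continuous_big; exact: add_continuous. Qed.

Lemma continuous_prod (K : numFieldType) (T : topologicalType) (I : Type)
    (r : seq I) (P : pred I) (f : I -> T -> K) :
  (forall i, P i -> continuous (f i)) ->
  continuous (fun x => \prod_(i <- r | P i) f i x).
Proof. by apply: continuous_big => z; exact: mul_continuous. Qed.

Lemma continuous_scale (K : numFieldType) (T : topologicalType) (a : K)
    (f : T -> K) :
  continuous f -> continuous (fun x => a * f x).
Proof. by move=> cf x; apply: cvgM; [exact: cvg_cst|exact: cf]. Qed.

Lemma continuous_coef (R : realType) j :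
  continuous (fun v : coef_seq R => coef v j : R[i]^o).
Proof. exact: (@proj_continuous nat (fun=> R[i]^o) j.-1). Qed.

(** The polynomial Q_j above: [resonant A j v] unfolds to
[coef v j = resonant_rhs A j v]. *)
Definition resonant_rhs {R : realType} (A : R) (j : nat) (v : coef_seq R) :
    R[i] :=
  \sum_(2 <= r < j.+1)
    (-1) ^+ r * (A%:C)%C ^ (2 * (1 - r%:Z)) *
    \sum_(b in compositions r j)
      coef_prod v b /
      \prod_(1 <= k < r) ((psum b k)%:R * (j%:R - (psum b k)%:R)).

Lemma continuous_resonant_rhs (R : realType) (A : R) j :
  continuous (resonant_rhs A j : coef_seq R -> R[i]^o).
Proof.
rewrite /resonant_rhs; apply: (@continuous_sum R[i]) => r _.
apply: (@continuous_scale R[i]); apply: (@continuous_sum R[i]) => b _.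
under eq_fun do rewrite mulrC.
apply: (@continuous_scale R[i]); apply: (@continuous_prod R[i]) => k _.
exact: continuous_coef.
Qed.

(** Since r >= 2, every factor of every monomial has index at most [j - 1]. *)
Lemma resonant_rhs_dfwith (R : realType) (A : R) j (v : coef_seq R) (t : R[i]) :
  resonant_rhs A j (@dfwith nat (fun=> R[i]) v j.-1 t) = resonant_rhs A j v.
Proof.
apply: eq_big_nat => r /andP[r2 _]; congr (_ * _).
apply: eq_bigr => b bj; congr (_ / _); apply: eq_bigr => i _.
have /andP[b0 bltj] := composition_part_lt _ _ _ i r2 bj.
rewrite /coef dfwithout// neq_ltn; apply/orP; right.
by rewrite -ltnS !prednK// (leq_trans _ bltj).
Qed.

Theorem proposition1p3 (R : realType) (A : sign -> R)
  (hA : forall s : sign, 0 < A s) (s : sign) :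
  meagre [set v : coef_seq R | exists j : nat, (2 <= j)%N /\ resonant (A s) j v].
Proof.
(* The coefficient V_(n+2) is the coordinate number n+1 of the sequence. *)
exists (fun n => [set v : coef_seq R | resonant (A s) n.+2 v]); split=> [n|].
  apply: (@nowhere_dense_coord_graph R[i] nat n.+1 (resonant_rhs (A s) n.+2)).
    exact: continuous_resonant_rhs.
  by move=> v t; exact: resonant_rhs_dfwith.
apply/seteqP; split=> v /=.
  by move=> [[|[|n]] [//= _ rv]]; exists n.
by move=> [n _ rv]; exists n.+2.
Qed.
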